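(* Let $v$ satisfy (V), $\overline{\rho}$ satisfy (I), and $\phi$ satisfy (P). - If (P1) (respectively (P2), (P3)) holds then, as long as it exists, the solution $x_0(t),\dots,x_n(t)$ of the follow-the-leader system associated with case (P1) (respectively (P2), (P3)) satisfies $$x_{i+1}(t)-x_i(t)\ge\frac{\ell_n}{\overline{R}}\,e^{-L't}\qquad\text{for } i\in\{0,\dots,n-1\}.$$ - If (V$^*$) and (P4) hold then, as long as it exists, the solution of the follow-the-leader system associated with case (P4) satisfies $$x_{i+1}(t)-x_i(t)\ge\frac{\ell_n}{R_{\max}}\qquad\text{for } i\in\{0,\dots,n-1\}.$$
   Context: Assumptions. (V) $v:[0,+\infty)\to[0,+\infty)$ is Lipschitz, non-negative, non-increasing, with $v_{\max}:=v(0)<+\infty$. (I) $\overline{\rho}\in L^\infty(\mathbb{R})\cap BV(\mathbb{R})$ is non-negative and compactly supported; throughout $\|\overline{\rho}\|_{L^1(\mathbb{R})}=1$. Put $\overline{R}:=\|\overline{\rho}\|_{L^\infty(\mathbb{R})}$. (P) $\phi\in W^{2,\infty}(\mathbb{R})$. Put $L':=v_{\max}\|\phi'\|_{L^\infty(\mathbb{R})}$. (P1) $\phi(x)\ge 0$ for all $x\in\mathbb{R}$; (P2) $\phi(x)\le 0$ for all $x\in\mathbb{R}$; (P3) $x\phi(x)\ge 0$ for all $x\in\mathbb{R}$; (P4) $x\phi(x)\le 0$ for all $x\in\mathbb{R}$. (V$^*$) There is $R_{\max}>0$ with $\overline{R}\le R_{\max}$, $v(\rho)>0$ for $\rho<R_{\max}$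 and $v(\rho)=0$ for $\rho\ge R_{\max}$. Particles. Let $[\overline{x}_{\min},\overline{x}_{\max}]$ be the convex hull of the support of $\overline{\rho}$. For a fixed, sufficiently large $n\in\mathbb{N}$ put $\ell_n:=1/n$, $\overline{x}_0:=\overline{x}_{\min}$, $\overline{x}_n:=\overline{x}_{\max}$ and, recursively, $\overline{x}_i:=\sup\{x\in\mathbb{R}:\int_{\overline{x}_{i-1}}^{x}\overline{\rho}(y)\,dy<\ell_n\}$ for $i=1,\dots,n-1$. Let $R_i(t):=\ell_n/(x_{i+1}(t)-x_i(t))$ for $i=0,\dots,n-1$ and, for cases (P3) and (P4), let $k_n:=\max\{i\in\{0,\dots,n\}:\overline{x}_i\le 0\}$. With initial conditions $x_i(0)=\overline{x}_i$ for $i=0,\dots,n$, the systems are: - case (P1): $\dot x_i=v(R_i)\phi(x_i)$ for $i\in\{0,\dots,n-1\}$, $\dot x_n=v_{\max}\phi(x_n)$; - case (P2): $\dot x_0=v_{\max}\phi(x_0)$, $\dot x_i=v(R_{i-1})\phi(x_i)$ for $i\in\{1,\dots,n\}$; - case (P3): $\dot x_0=v_{\max}\phi(x_0)$, $\dot x_i=v(R_{i-1})\phi(x_i)$ for $i\in\{1,\dots,k_n\}$, $\dot x_i=v(R_i)\phi(x_i)$ for $i\in\{k_n+1,\dots,n-1\}$, $\dot x_n=v_{\max}\phi(x_n)$; - case (P4): $\dot x_i=v(R_i)\phi(x_i)$ for $i\in\{0,\dots,k_n\}$, $\dot x_i=v(R_{i-1})\phi(x_i)$ for $i\in\{k_n+1,\dots,n\}$.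 ''As long as it exists'' means on any time interval $[0,\tau)$, $0<\tau\le+\infty$, on which the solution exists; on such an interval the strict order $x_0(t)<\dots<x_n(t)$ is kept, so that the $R_i$ are finite. *)

(* Defs.v *)
From HB Require Import structures.
From mathcomp Require Import all_boot all_order all_algebra.
From mathcomp Require Import all_classical all_reals all_analysis.

Set Implicit Arguments.
Unset Strict Implicit.
Unset Printing Implicit Defensive.

Import Order.TTheory GRing.Theory Num.Theory.
Import numFieldNormedType.Exports.

Local Open Scope classical_set_scope.
Local Open Scope ring_scope.

(* Elements of L^oo, BV and W^{k,oo} are represented by measurable functions
   R -> R; the notions below, C1c apart, only depend on their a.e. class. *)
Section FunctionSpaces.
Context {R : realType}.
Local Notation mu := (@lebesgue_measure R).

Definition Loo (u : R -> R) : Prop := u \in Lfun mu +oo%E.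

Definition norm_oo (u : R -> R) : R := fine ('N[mu]_+oo[EFin \o u])%E.

(* C^1_c(R) *)
Definition C1c (psi : R -> R) : Prop :=
  [/\ forall x, derivable psi x 1,
      continuous (derive1 psi) &
      exists M : R, forall x, M < `|x| -> psi x = 0].

(* BV(R): integrable functions of finite variation, the variation of u being
   the supremum of the integrals of u psi' over psi in C^1_c, |psi| <= 1. *)
Definition BV (u : R -> R) : Prop :=
  u \in Lfun mu 1%E /\
  exists C : R, forall psi, C1c psi -> (forall x, `|psi x| <= 1) ->
    \int[mu]_x (u x * derive1 psi x) <= C.

Definition weak_derivative (u w : R -> R) : Prop :=
  [/\ locally_integrable setT u,
      locally_integrable setT w &
      forall psi, C1c psi ->
        \int[mu]_x (u x * derive1 psi x) = - \int[mu]_x (w x * psi x)].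

(* u \in W^{k,oo}(R) *)
Fixpoint Woo (k : nat) (u : R -> R) : Prop :=
  if k is m.+1 then Loo u /\ exists w, weak_derivative u w /\ Woo m w
  else Loo u.

(* The support of the measure u dx: the complement of the largest open set on
   which u vanishes almost everywhere. *)
Definition ess_support (u : R -> R) : set R :=
  [set x | forall U, nbhs x U -> ~ {ae mu, forall y, U y -> u y = 0}].

End FunctionSpaces.

Section Assumptions.
Context {R : realType}.
Local Notation mu := (@lebesgue_measure R).

(* v : [0,+oo) -> [0,+oo) is a function on R whose values at negative
   arguments are irrelevant. *)
Definition assumption_V (v : R -> R) : Prop :=
  [/\ [lipschitz v r | r in [set r | 0 <= r]],
      forall r : R, 0 <= r -> 0 <= v r &
      forall r s : R, 0 <= r -> r <= s -> v s <= v r].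

Definition assumption_I (rho : R -> R) : Prop :=
  [/\ Loo rho, BV rho,
      {ae mu, forall x, 0 <= rho x},
      compact (ess_support rho) &
      ('N[mu]_1[EFin \o rho] = 1)%E].

(* phi \in W^{2,oo}(R) with weak derivative dphi, phi being the continuous
   representative of its class: [Woo 2 phi] with a name for its witness. *)
Definition assumption_P (phi dphi : R -> R) : Prop :=
  [/\ continuous phi, Loo phi, weak_derivative phi dphi & Woo 1 dphi].

Definition assumption_Vstar (v : R -> R) (Rbar Rmax : R) : Prop :=
  [/\ 0 < Rmax, Rbar <= Rmax,
      forall r : R, 0 <= r -> r < Rmax -> 0 < v r &
      forall r : R, Rmax <= r -> v r = 0].

End Assumptions.

Section Particles.
Context {R : realType}.
Local Notation mu := (@lebesgue_measure R).

Definition xmin (rho : R -> R) : R := inf (ess_support rho).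
Definition xmax (rho : R -> R) : R := sup (ess_support rho).

Definition ell (n : nat) : R := n%:R^-1.

(* For x < a the interval [a, x] is empty and its integral is 0, whereas the
   oriented integral from a to x is <= 0: such x satisfy the condition
   "integral < ell" in both readings. *)
Fixpoint xbar_rec (rho : R -> R) (n i : nat) : R :=
  if i is j.+1 then
    sup [set x : R |
          \int[mu]_(y in `[xbar_rec rho n j, x]%classic) rho y < ell n]
  else xmin rho.

Definition xbar (rho : R -> R) (n i : nat) : R :=
  if i == n then xmax rho else xbar_rec rho n i.

(* k_n, with the convention k_n = -1 when every particle starts in x > 0. *)
Definition k_index (rho : R -> R) (n : nat) : int :=
  \big[Num.max/(-1)]_(i < n.+1 | xbar rho n i <= 0) (i%:Z).

(* A configuration of the n + 1 particles is a sequence y : nat -> R of which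
   only the terms y 0, ..., y n matter. *)
Definition density (n : nat) (y : nat -> R) (i : nat) : R :=
  ell n / (y i.+1 - y i).

(* Speed of particle i adjusted to the particle on its right, resp. left;
   a particle with no such neighbour has speed v_max = v 0. *)
Definition speed_right (v : R -> R) (n : nat) (y : nat -> R) (i : nat) : R :=
  if (i < n)%N then v (density n y i) else v 0.

Definition speed_left (v : R -> R) (n : nat) (y : nat -> R) (i : nat) : R :=
  if i is j.+1 then v (density n y j) else v 0.

(* The factor of phi(x_i) in the four systems. When k = n, the third system
   has two competing lines for x_n in the usual display, and the first one,
   v(R_{n-1}), is kept; the fourth one refers to a density R_n ahead of x_n,
   which is read as 0. *)
Definition speed1 (v : R -> R) (n : nat) := speed_right v n.

Definition speed2 (v : R -> R) (n : nat) := speed_left v n.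

Definition speed3 (v : R -> R) (n : nat) (k : int) (y : nat -> R) (i : nat) :=
  if i%:Z <= k then speed_left v n y i else speed_right v n y i.

Definition speed4 (v : R -> R) (n : nat) (k : int) (y : nat -> R) (i : nat) :=
  if i%:Z <= k then speed_right v n y i else speed_left v n y i.

(* x is a solution on [0, tau), 0 < tau <= +oo, of x_i' = V_i(x) phi(x_i) with
   initial datum x0.  The densities only make sense as arguments of v while the
   particles are strictly ordered, which is part of being a solution. *)
Definition ftl_solution (n : nat) (V : (nat -> R) -> nat -> R) (phi : R -> R)
    (x0 : nat -> R) (tau : \bar R) (x : nat -> R -> R) : Prop :=
  [/\ (0 < tau)%E,
      forall i, (i <= n)%N -> x i 0 = x0 i,
      forall i, (i <= n)%N ->
        {within [set t | 0 <= t /\ (t%:E < tau)%E], continuous (x i)},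
      forall (i : nat) (t : R), (i < n)%N -> 0 <= t -> (t%:E < tau)%E -> x i t < x i.+1 t &
      forall (i : nat) (t : R), (i <= n)%N -> 0 < t -> (t%:E < tau)%E ->
        is_derive t 1 (x i) (V (x^~ t) i * phi (x i t))].

End Particles.

(* Main.v *)
Require Import Defs.
From HB Require Import structures.
From mathcomp Require Import all_boot all_order all_algebra.
From mathcomp Require Import all_classical all_reals all_analysis.
From mathcomp Require Import measurable_realfun ess_sup_inf hoelder.
From mathcomp Require Import zify ring lra.

Set Implicit Arguments.
Unset Strict Implicit.
Unset Printing Implicit Defensive.

Import Order.TTheory GRing.Theory Num.Theory.
Import numFieldNormedType.Exports.

Local Open Scope classical_set_scope.
Local Open Scope ring_scope.

(** The estimates are maximum principles for the gaps between neighbours, and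
each of them is an instance of one scalar fact ([barrier]): if [c <= g 0] and
[(exp(K t) g)' >= 0] at every time at which [exp(K t) g < c], then
[c <= exp(K t) g] at all times.

Cases (P1) to (P3) have a common shape ([diverging_gap]): the particles of
index [<= k] move to the left and look at their left neighbour, the others
move to the right and look at their right neighbour; (P1) is [k = -1] and (P2)
is [k = n].  Take a gap [i > k] that falls below the bound while the gap
[i + 1] satisfies it.  Then [R_i > R_(i+1)], so the leading particle [i + 1] is
at least as fast as [v(R_i)], and
[x_(i+1)' - x_i' >= v(R_i) (phi(x_(i+1)) - phi(x_i)) >= - L' (x_(i+1) - x_i)],
which says that [exp(L' t)] times the gap does not decrease.  The bound thus
propagates from the rightmost gap, whose leader has the speed factor [v 0], to the
left; it propagates symmetrically from the leftmost gap up to [k], and the gap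
[k] itself only opens.  In case (P4) ([converging_gap]) a gap shorter than
[ell_n / Rmax] has a density above [Rmax], where [v] vanishes: the particle
whose speed depends on that density is at rest, and the other particle of the
pair is at rest too or moves away from it.

In cases (P3) and (P4), [phi] vanishes at [0], and a solution of
[x' = V(t) phi(x)] cannot cross a zero of the Lipschitz function [phi]
([equilibrium_barrier]).  Particles therefore keep their sign, and [phi(x_i)]
keeps the sign that the two previous arguments require.

Two facts have to be extracted from the function spaces.  First, the
continuous representative of a function with bounded weak derivative is
Lipschitz with constant the essential bound of that derivative
([weak_derivative_lipschitz]): test the weak derivative against a smoothed
indicator of [[a, b]].  Second, the initial gaps are at least [ell_n / Rbar]
([initial_gap]): each interval between neighbours carries mass at least
[ell_n], and its mass is at most [Rbar] times its length. *)

(** * The truncated parabola *)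

(** A nonnegative function of class [C^1] that vanishes exactly where
[x <= 0].  It serves as penalty function for one-sided constraints, and quadratic
splines are combinations of its translates. *)
Definition pos_sq {R : realType} (x : R) : R := Num.max x 0 ^+ 2.

Lemma is_derive_pos_sq (R : realType) (x : R) :
  is_derive x 1 (@pos_sq R) (2 * Num.max x 0).
Proof.
have [x0|x0|->] := ltgtP x 0.
- rewrite mulr0.
  have h : {near x, cst 0 =1 @pos_sq R}.
    near=> y; rewrite /pos_sq max_r ?expr0n//.
    by apply/ltW; near: y; exact: lt_nbhsl.
  exact: near_eq_is_derive h _.
- have h : {near x, (fun y => y ^+ 2) =1 @pos_sq R}.
    near=> y; rewrite /pos_sq max_l//.
    by apply/ltW; near: y; exact: lt_nbhsr.
  apply: near_eq_is_derive h _.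
  apply: is_derive_eq; rewrite /GRing.scale/=; ring.
- rewrite mulr0.
  have h : h^-1 *: (@pos_sq R (h *: (1:R) + 0) - @pos_sq R 0) @[h --> 0^'] --> (0:R).
    apply/cvgrPdist_le => e e0; near=> h.
    have h0 : h != 0 by near: h; exact: nbhs_dnbhs_neq.
    have he : `|h| <= e by near: h; apply: dnbhs0_le.
    rewrite sub0r normrN /pos_sq maxxx expr0n/= subr0 addr0 /GRing.scale/= mulr1.
    apply: le_trans he; case: (leP h 0) => hh.
      by rewrite expr0n/= mulr0 normr0.
    by rewrite expr2 mulrA mulVf// mul1r.
  apply: DeriveDef; last exact: cvg_lim h.
  by apply/cvg_ex; exists 0.
Unshelve. all: by end_near.
Qed.

Lemma continuous_pos_sq (R : realType) : continuous (@pos_sq R).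
Proof.
move=> x; apply/differentiable_continuous/derivable1_diffP.
by have [] := is_derive_pos_sq x.
Qed.

(** * Barriers for differential inequalities *)

(** The penalty [pos_sq (c - exp(K t) g)] starts from zero and cannot grow: its
derivative vanishes as long as the constraint holds, and is nonpositive as soon
as the constraint is violated.  So it is zero at all times. *)
Lemma barrier (R : realType) (tau : \bar R) (K c : R) (g dg : R -> R) :
  {within [set t | 0 <= t /\ (t%:E < tau)%E], continuous g} ->
  (forall t : R, 0 < t -> (t%:E < tau)%E -> is_derive t 1 g (dg t)) ->
  c <= g 0 ->
  (forall t : R, 0 < t -> (t%:E < tau)%E -> expR (K * t) * g t < c ->
     0 <= dg t + K * g t) ->
  forall t : R, 0 <= t -> (t%:E < tau)%E -> c <= expR (K * t) * g t.
Proof.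
move=> cg dgE c0 hbar t t0 ttau.
pose w (s : R) := expR (K * s) * g s.
pose h := @pos_sq R \o (fun s => c - w s).
have itau s : s \in `]0, t[ -> 0 < s /\ (s%:E < tau)%E.
  rewrite in_itv/= => /andP[s0 st]; split => //.
  by apply: lt_trans ttau; rewrite lte_fin.
have dh s : s \in `]0, t[ ->
    is_derive s 1 h
      (- (2 * Num.max (c - w s) 0 * (expR (K * s) * (dg s + K * g s)))).
  move=> /itau[s0 st]; have dgs := dgE s s0 st.
  have dw : is_derive s 1 (fun s => c - w s) (- (expR (K * s) * (dg s + K * g s))).
    have de : is_derive s 1 (fun s => expR (K * s)) (K * expR (K * s)).
      have dk : is_derive s 1 ( *%R K) K.
        by apply: is_derive_eq; rewrite /GRing.scale/= mulr1.
      rewrite mulrC; exact: (@is_derive1_comp _ expR ( *%R K)).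
    apply: is_derive_eq; rewrite /GRing.scale/=; ring.
  have dp := is_derive_pos_sq (c - w s).
  have := @is_derive1_comp _ (@pos_sq R) (fun s => c - w s) s _ _ dp dw.
  by rewrite mulrN.
have wc : {within `[0, t], continuous h}.
  apply: (@continuous_subspaceW _ _ _ [set s | 0 <= s /\ (s%:E < tau)%E]).
    move=> s /=; rewrite in_itv/= => /andP[s0 st]; split => //.
    by apply: le_lt_trans ttau; rewrite lee_fin.
  have cE : continuous (fun s : R => expR (K * s)).
    move=> s; apply: continuous_comp; last exact: continuous_expR.
    exact: mulrl_continuous.
  move=> s; apply: (@continuous_comp (subspace _) R R
    (fun s : subspace _ => c - w s) (@pos_sq R)); last exact: continuous_pos_sq.
  apply: continuousB; first exact: cst_continuous.
  apply: continuousM; last exact: cg.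
  exact/continuous_subspaceT.
have ht : h t <= h 0.
  apply: (@ler0_derive1_le_cc _ h 0 t) => //.
  - by move=> s /dh[].
  - move=> s st; have [s0 stau] := itau _ st.
    rewrite derive1E; have [_ ->] := dh _ st.
    rewrite oppr_le0; case: (ltP (c - w s) 0) => [cw|cw].
      by rewrite mulr0 mul0r.
    case: (ltgtP (c - w s) 0) cw => // [cw _|-> _]; last by rewrite mulr0 mul0r.
    apply: mulr_ge0; first by rewrite mulr_ge0// ltW.
    apply: mulr_ge0; first exact: expR_ge0.
    by apply: hbar => //; rewrite -subr_gt0.
  - by rewrite in_itv/= lexx t0.
  - by rewrite in_itv/= lexx t0.
have h0 : h 0 = 0.
  rewrite /h /pos_sq /= /w mulr0 expR0 mul1r max_r ?expr0n//.
  by rewrite subr_le0.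
have : h t = 0 by apply/eqP; rewrite eq_le sqr_ge0 andbT; rewrite h0 in ht.
rewrite /h /pos_sq/= => /eqP; rewrite sqrf_eq0 => /eqP H.
by rewrite -subr_le0 -H le_max lexx.
Qed.

(** Where [x < 0] the Lipschitz bound gives [V phi(x) >= vmax L x], which is the
differential inequality that keeps [exp(- vmax L t) x] above [0]. *)
Lemma equilibrium_barrier (R : realType) (tau : \bar R) (phi x V : R -> R)
    (L vmax : R) :
  phi 0 = 0 -> (forall a b, `|phi b - phi a| <= L * `|b - a|) ->
  (forall t : R, 0 < t -> (t%:E < tau)%E -> 0 <= V t <= vmax) ->
  {within [set t | 0 <= t /\ (t%:E < tau)%E], continuous x} ->
  (forall t : R, 0 < t -> (t%:E < tau)%E ->
     is_derive t 1 x (V t * phi (x t))) ->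
  0 <= x 0 ->
  forall t : R, 0 <= t -> (t%:E < tau)%E -> 0 <= x t.
Proof.
move=> phi0 lip V0 cx dx x0 t t0 ttau.
rewrite -(pmulr_rge0 _ (expR_gt0 (- (vmax * L) * t))).
apply: (barrier cx dx) => // s s0 stau.
rewrite pmulr_rlt0 ?expR_gt0// => xs.
have := lip 0 (x s); rewrite phi0 !subr0 (ltr0_norm xs) ler_norml => /andP[h _].
have /andP[V1 V2] := V0 s s0 stau.
have h1 : V s * (L * x s) <= V s * phi (x s).
  by rewrite ler_wpM2l//; lra.
have L0 : 0 <= L.
  by have := lip 0 1; rewrite subr0 normr1 mulr1; apply: le_trans.
have h2 : vmax * (- (L * x s)) >= V s * (- (L * x s)).
  by rewrite ler_wpM2r// oppr_ge0 nmulr_lle0.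
lra.
Qed.

(** The reflection [x |-> - x] preserves the class of equations considered. *)
Lemma equilibrium_barrierN (R : realType) (tau : \bar R) (phi x V : R -> R)
    (L vmax : R) :
  phi 0 = 0 -> (forall a b, `|phi b - phi a| <= L * `|b - a|) ->
  (forall t : R, 0 < t -> (t%:E < tau)%E -> 0 <= V t <= vmax) ->
  {within [set t | 0 <= t /\ (t%:E < tau)%E], continuous x} ->
  (forall t : R, 0 < t -> (t%:E < tau)%E ->
     is_derive t 1 x (V t * phi (x t))) ->
  x 0 <= 0 ->
  forall t : R, 0 <= t -> (t%:E < tau)%E -> x t <= 0.
Proof.
move=> phi0 lip V0 cx dx x0 t t0 ttau; rewrite -oppr_ge0.
apply: (@equilibrium_barrier _ tau (fun y => - phi (- y)) (fun t => - x t) V L vmax)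
  => //.
- by rewrite oppr0 phi0 oppr0.
- move=> a b.
  have -> : - phi (- b) - - phi (- a) = - (phi (- b) - phi (- a)) by ring.
  have -> : b - a = - (- b - - a) by ring.
  by rewrite !normrN.
- by move=> s; apply: continuousN; exact: cx.
- move=> s s0 stau; have dxs := dx s s0 stau.
  by apply: is_derive_eq; rewrite opprK mulrN.
- by rewrite oppr_ge0.
Qed.

(** * Gaps of a follow-the-leader system *)

Section FollowTheLeader.
Context {R : realType} (n : nat) (v phi : R -> R) (L : R).
Context (v_ge0 : forall r : R, 0 <= r -> 0 <= v r).
Context (v_ninc : forall r s : R, 0 <= r -> r <= s -> v s <= v r).
Context (phi_lip : forall a b : R, `|phi b - phi a| <= L * `|b - a|).
Context (V : (nat -> R) -> nat -> R) (x0 : nat -> R) (tau : \bar R).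
Context (x : nat -> R -> R) (x_sol : ftl_solution n V phi x0 tau x).

Lemma gap_barrier (K c : R) (i : nat) : (i < n)%N ->
  c <= x0 i.+1 - x0 i ->
  (forall t : R, 0 < t -> (t%:E < tau)%E -> expR (K * t) * (x i.+1 t - x i t) < c ->
     0 <= V (x^~ t) i.+1 * phi (x i.+1 t) - V (x^~ t) i * phi (x i t)
          + K * (x i.+1 t - x i t)) ->
  forall t : R, 0 <= t -> (t%:E < tau)%E ->
    c <= expR (K * t) * (x i.+1 t - x i t).
Proof.
case: x_sol => tau0 xi xc _ xd ltin c0 h t t0 ttau.
apply: (@barrier _ tau K c (fun t => x i.+1 t - x i t)
  (fun t => V (x^~ t) i.+1 * phi (x i.+1 t) - V (x^~ t) i * phi (x i t))) => //.
- by move=> s; apply: continuousB; apply: xc => //; exact: ltnW.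
- move=> s s0 st; have d1 := xd i.+1 s ltin s0 st.
  have d2 := xd i s (ltnW ltin) s0 st.
  exact: is_deriveB.
- by rewrite !xi// ltnW.
Qed.

Lemma density_ge0 (i : nat) (t : R) : (i < n)%N -> 0 <= t -> (t%:E < tau)%E ->
  0 <= density n (x^~ t) i.
Proof.
case: x_sol => _ _ _ xs _ ltin t0 tt.
by rewrite divr_ge0 ?invr_ge0// subr_ge0 ltW// xs.
Qed.

Lemma speed_right_bounds (i : nat) (t : R) :
  (i <= n)%N -> 0 <= t -> (t%:E < tau)%E ->
  0 <= speed_right v n (x^~ t) i <= v 0.
Proof.
move=> lein t0 tt; rewrite /speed_right; case: ifPn => hi.
  by rewrite v_ge0 ?v_ninc// density_ge0.
by rewrite v_ge0 /=.
Qed.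

Lemma speed_left_bounds (i : nat) (t : R) :
  (i <= n)%N -> 0 <= t -> (t%:E < tau)%E ->
  0 <= speed_left v n (x^~ t) i <= v 0.
Proof.
move=> lein t0 tt; rewrite /speed_left; case: i lein => [|i] hi.
  by rewrite v_ge0 /=.
by rewrite v_ge0 ?v_ninc// density_ge0.
Qed.

(** Two particles driven with a common speed factor [u] approach each other at
most exponentially; this is where the rate [v 0 * L] comes from. *)
Lemma lipschitz_mul_ge (u a b : R) : 0 <= u <= v 0 -> a <= b ->
  0 <= u * phi b - u * phi a + v 0 * L * (b - a).
Proof.
move=> /andP[u0 uv] ab.
have := phi_lip a b; rewrite [`|b - a|]ger0_norm ?subr_ge0// => h.
have h1 : u * `|phi b - phi a| <= v 0 * (L * (b - a)).
  by apply: ler_pM.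
have h2 : - (u * `|phi b - phi a|) <= u * (phi b - phi a).
  by rewrite -mulrN ler_wpM2l// lerNl -normrN ler_norm.
lra.
Qed.

Lemma le_density (i j : nat) (t : R) : (i < n)%N -> (j < n)%N ->
  0 <= t -> (t%:E < tau)%E ->
  x i.+1 t - x i t <= x j.+1 t - x j t ->
  v (density n (x^~ t) i) <= v (density n (x^~ t) j).
Proof.
move=> ltin ltjn t0 tt h; apply: v_ninc; first exact: density_ge0.
case: x_sol => _ _ _ xs _.
rewrite /density ler_wpM2l ?invr_ge0// lef_pV2// posrE subr_gt0 xs//.
Qed.

Lemma speed3_left (k : int) (y : nat -> R) (i : nat) :
  i%:Z <= k -> speed3 v n k y i = speed_left v n y i.
Proof. by rewrite /speed3 => ->. Qed.

Lemma speed3_right (k : int) (y : nat -> R) (i : nat) :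
  k < i%:Z -> speed3 v n k y i = speed_right v n y i.
Proof. by rewrite /speed3 leNgt => ->. Qed.

(** The bound spreads from the two extreme gaps towards the middle one, because
a gap is only tested at times when it is shorter than the bound, hence shorter
than its outer neighbour. *)
Lemma diverging_gap (k : int) (c : R) :
  (forall y i, (i <= n)%N -> V y i = speed3 v n k y i) ->
  (forall (i : nat) (t : R), (i <= n)%N -> i%:Z <= k -> 0 <= t -> (t%:E < tau)%E ->
     phi (x i t) <= 0) ->
  (forall (i : nat) (t : R), (i <= n)%N -> k < i%:Z -> 0 <= t -> (t%:E < tau)%E ->
     0 <= phi (x i t)) ->
  (forall i : nat, (i < n)%N -> c <= x0 i.+1 - x0 i) ->
  forall (i : nat) (t : R), (i < n)%N -> 0 <= t -> (t%:E < tau)%E ->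
    c <= expR (v 0 * L * t) * (x i.+1 t - x i t).
Proof.
move=> VE phiN phiP c0.
have v00 : 0 <= v 0 by exact: v_ge0.
have [_ _ _ xs _] := x_sol.
(* Giving both particles of the gap the speed factor [u] can only make the gap
   grow more slowly. *)
have key (i : nat) : (i < n)%N ->
  (forall t : R, 0 < t -> (t%:E < tau)%E ->
     expR (v 0 * L * t) * (x i.+1 t - x i t) < c ->
     exists2 u, 0 <= u <= v 0 &
       u * phi (x i.+1 t) <= V (x^~ t) i.+1 * phi (x i.+1 t) /\
       V (x^~ t) i * phi (x i t) <= u * phi (x i t)) ->
  forall t : R, 0 <= t -> (t%:E < tau)%E ->
    c <= expR (v 0 * L * t) * (x i.+1 t - x i t).
  move=> ltin hu; apply: gap_barrier => //; first exact: c0.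
  move=> t t0 tt /(hu t t0 tt)[u u0 [h1 h2]].
  have := lipschitz_mul_ge u0 (ltW (xs i t ltin (ltW t0) tt)).
  lra.
have gap_lt (i j : nat) (t : R) :
    c <= expR (v 0 * L * t) * (x j.+1 t - x j t) ->
    expR (v 0 * L * t) * (x i.+1 t - x i t) < c ->
    x i.+1 t - x i t <= x j.+1 t - x j t.
  move=> hj hi; rewrite -(ler_pM2l (expR_gt0 (v 0 * L * t))).
  exact: ltW (lt_le_trans hi hj).
have right (m i : nat) : (i + m.+1)%N = n -> k < i%:Z ->
  forall t : R, 0 <= t -> (t%:E < tau)%E ->
    c <= expR (v 0 * L * t) * (x i.+1 t - x i t).
  elim: m i => [|m IH] i im ki;
    have ki1 : k < i.+1%:Z by apply: lt_trans ki _; rewrite ltz_nat.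
  - have ltin : (i < n)%N by lia.
    apply: key => // t t0 tt _; have t0' := ltW t0.
    have lein := ltnW ltin; exists (speed_right v n (x^~ t) i).
      by apply: speed_right_bounds => //; lia.
    rewrite !VE// !speed3_right//.
    split=> //; apply: ler_wpM2r.
      by apply: phiP => //; lia.
    rewrite {2}/speed_right (_ : (i.+1 < n)%N = false); last by lia.
    by case/andP: (speed_right_bounds (ltnW ltin) (ltW t0) tt).
  have ltin : (i < n)%N by lia.
  have ltin1 : (i.+1 < n)%N by lia.
  have IHi := IH i.+1 ltac:(lia) ltac:(lia).
  apply: key => // t t0 tt hlt; have t0' := ltW t0.
  have lein := ltnW ltin; exists (speed_right v n (x^~ t) i).
    by apply: speed_right_bounds => //; lia.
  rewrite !VE// !speed3_right//.
  split=> //; apply: ler_wpM2r.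
    by apply: phiP => //; lia.
  rewrite /speed_right ltin ltin1; apply: le_density => //.
  by apply: gap_lt hlt; apply: IHi.
have left (i : nat) : (i < n)%N -> i%:Z < k ->
  forall t : R, 0 <= t -> (t%:E < tau)%E ->
    c <= expR (v 0 * L * t) * (x i.+1 t - x i t).
  elim: i => [|i IH] ltin ki; apply: key => // t t0 tt hlt;
    have t0' := ltW t0; have lein := ltnW ltin.
    exists (speed_left v n (x^~ t) 1).
      by apply: speed_left_bounds => //; lia.
    rewrite !VE// !speed3_left//; last exact: ltW.
    split=> //; apply: ler_wnM2r; first by apply: phiN => //; lia.
    by rewrite {2}/speed_left; case/andP: (speed_left_bounds ltin (ltW t0) tt).
  have ltin1 : (i < n)%N by lia.
  have IHi := IH ltin1 ltac:(lia).
  exists (speed_left v n (x^~ t) i.+2).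
    by apply: speed_left_bounds => //; lia.
  rewrite !VE// !speed3_left//; last exact: ltW.
  split=> //; apply: ler_wnM2r; first by apply: phiN => //; lia.
  rewrite /speed_left; apply: le_density => //.
  by apply: gap_lt hlt; apply: IHi.
move=> i t ltin.
case: (ltgtP i%:Z k) => [ik|ki|ik]; first exact: left.
  by apply: (right (n - i.+1)%N) => //; lia.
(* The two middle particles move apart, so any [u] between [0] and their
   speeds would do. *)
apply: key => // {}t t0 tt _; have t0' := ltW t0; have lein := ltnW ltin.
exists 0; first by rewrite lexx.
rewrite !mul0r !VE//.
have ki1 : k < i.+1%:Z by rewrite -ik ltz_nat.
rewrite speed3_right ?speed3_left ?ik//.
split.
  apply: mulr_ge0; last by apply: phiP => //; lia.
  by case/andP: (speed_right_bounds ltin (ltW t0) tt).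
apply: mulr_ge0_le0; last by apply: phiN => //; lia.
by case/andP: (speed_left_bounds (ltnW ltin) (ltW t0) tt).
Qed.

(** A gap below [ell n / Rmax] stops the particle whose speed it governs, and
the other particle of the pair stops too or moves away from it. *)
Lemma converging_gap (k : int) (Rmax : R) :
  0 < Rmax -> (forall r, Rmax <= r -> v r = 0) ->
  (forall y i, (i <= n)%N -> V y i = speed4 v n k y i) ->
  (forall (i : nat) (t : R), (i <= n)%N -> i%:Z <= k -> 0 <= t -> (t%:E < tau)%E ->
     0 <= phi (x i t)) ->
  (forall (i : nat) (t : R), (i <= n)%N -> k < i%:Z -> 0 <= t -> (t%:E < tau)%E ->
     phi (x i t) <= 0) ->
  (forall i : nat, (i < n)%N -> ell n / Rmax <= x0 i.+1 - x0 i) ->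
  forall (i : nat) (t : R), (i < n)%N -> 0 <= t -> (t%:E < tau)%E ->
    ell n / Rmax <= x i.+1 t - x i t.
Proof.
move=> Rmax0 vR VE phiP phiN c0 i t ltin t0 tt.
have [_ _ _ xs _] := x_sol.
suff : ell n / Rmax <= expR (0 * t) * (x i.+1 t - x i t).
  by rewrite mul0r expR0 mul1r.
apply: gap_barrier => //; first exact: c0.
move=> {t0 tt} {}t t0 tt; have t0' := ltW t0; have lein := ltnW ltin.
rewrite !mul0r expR0 mul1r addr0 => hlt.
have stop : v (density n (x^~ t) i) = 0.
  apply: vR; rewrite /density ler_pdivlMr ?subr_gt0 ?xs//.
  by rewrite mulrC -ler_pdivlMr// ltW.
have VR j : (j <= n)%N -> 0 <= speed_right v n (x^~ t) j.
  by move=> jn; case/andP: (speed_right_bounds jn (ltW t0) tt).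
have VL j : (j <= n)%N -> 0 <= speed_left v n (x^~ t) j.
  by move=> jn; case/andP: (speed_left_bounds jn (ltW t0) tt).
rewrite !VE//.
rewrite /speed4; case: ifPn => ik1.
  rewrite (_ : i%:Z <= k); last by lia.
  rewrite [X in _ - X * _]/speed_right ltin stop mul0r subr0.
  by apply: mulr_ge0; [exact: VR | apply: phiP => //; exact: ltW].
rewrite [X in X * _ - _]/= stop mul0r sub0r oppr_ge0; case: ifPn => ik.
  by rewrite /speed_right ltin stop mul0r.
apply: mulr_ge0_le0; first by apply: VL; exact: ltnW.
by apply: phiN => //; lia.
Qed.

End FollowTheLeader.

(** * Essential bounds *)

Section EssentialBounds.
Context {R : realType}.
Local Notation mu := (@lebesgue_measure R).

Lemma Loo_measurable (u : R -> R) : Loo u -> measurable_fun setT u.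
Proof. by move=> /andP[]; rewrite inE. Qed.

Lemma norm_oo_ge0 (u : R -> R) : 0 <= norm_oo u.
Proof. by rewrite fine_ge0// Lnorm_ge0. Qed.

Lemma ae_le_norm_oo (u : R -> R) :
  Loo u -> {ae mu, forall x, `|u x| <= norm_oo u}.
Proof.
move=> /andP[_]; rewrite inE => /= fu.
have muT : (0 < mu [set: R])%E.
  by rewrite -set_itvE lebesgue_measure_itv/= addye.
have NE : (norm_oo u)%:E = ess_sup mu (abse \o (EFin \o u)).
  rewrite /norm_oo fineK; last by rewrite ge0_fin_numE ?Lnorm_ge0.
  by rewrite unlock /Lnorm muT.
have := ess_sup_ge mu (abse \o (EFin \o u)).
by rewrite -NE; apply: filterS => x /=; rewrite lee_fin.
Qed.

Lemma Rintegral_ae_bounded (f : R -> R) (a b M : R) : a <= b -> 0 <= M ->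
  measurable_fun `[a, b] f ->
  {ae mu, forall x, x \in `[a, b] -> `|f x| <= M} ->
  mu.-integrable `[a, b] (EFin \o f) /\
  `|\int[mu]_(x in `[a, b]) f x| <= M * (b - a).
Proof.
move=> ab M0 mf fM.
have /measurable_EFinP mfE := mf.
have muab : mu `[a, b] = (b - a)%:E.
  rewrite lebesgue_measure_itv/= lte_fin; case: ltgtP ab => // -> _.
  by rewrite subrr.
have le : (\int[mu]_(x in `[a, b]) `|(f x)%:E| <= (M * (b - a))%:E)%E.
  rewrite EFinM -muab; apply: (integral_le_bound M%:E) => //.
have int : mu.-integrable `[a, b] (EFin \o f).
  by apply/integrableP; split => //; apply: le_lt_trans le _; rewrite ltry.
split=> //; rewrite -lee_fin EFin_normr_Rintegral//.
by apply: le_trans le; exact: le_abse_integral.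
Qed.

End EssentialBounds.

(** * Lipschitz representatives of functions with bounded weak derivative *)

Section SmoothStep.
Context {R : realType}.
Local Notation mu := (@lebesgue_measure R).

(** The quadratic spline with nodes [0], [1/2] and [1] that rises from [0] to
[1]: a primitive of [tent], of class [C^1]. *)
Definition smooth_step (x : R) : R :=
  2 * (pos_sq x - 2 * pos_sq (x - 2^-1) + pos_sq (x - 1)).

(** The hat function on [[0, 1]] of height [2], hence of integral [1]. *)
Definition tent (x : R) : R :=
  4 * (Num.max x 0 - 2 * Num.max (x - 2^-1) 0 + Num.max (x - 1) 0).

Lemma is_derive_smooth_step (x : R) : is_derive x 1 smooth_step (tent x).
Proof.
have dp (c : R) : is_derive x 1 (fun y => pos_sq (y - c)) (2 * Num.max (x - c) 0).
  have dB : is_derive x 1 (fun y : R => y - c) 1.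
    by apply: is_derive_eq; rewrite subr0.
  rewrite -[X in is_derive _ _ _ X]mulr1.
  exact: (@is_derive1_comp _ (@pos_sq R) (fun y => y - c) x _ _
    (is_derive_pos_sq (x - c)) dB).
have d0 := is_derive_pos_sq x.
have d1 := dp 2^-1.
have d2 := dp 1.
apply: is_derive_eq; rewrite /tent /GRing.scale/=; ring.
Qed.

Lemma continuous_tent : continuous tent.
Proof.
have cm (c : R) : continuous (fun y => Num.max (y - c) 0).
  move=> y; apply: (@continuous_max _ _ (fun y => y - c) (cst 0)).
    by apply: cvgB; [exact: cvg_id | exact: cvg_cst].
  exact: cst_continuous.
have cm0 : continuous (fun y : R => Num.max y 0).
  move=> y; apply: (@continuous_max _ _ id (cst 0)); first exact: id.
  exact: cst_continuous.
rewrite /tent => x; apply: cvgM; first exact: cvg_cst.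
apply: cvgD; last exact: cm.
apply: cvgB; first exact: cm0.
apply: cvgM; first exact: cvg_cst.
exact: cm.
Qed.

Lemma tent_ge0 (x : R) : 0 <= tent x.
Proof.
rewrite /tent; case: (leP x 0); case: (leP (x - 2^-1) 0); case: (leP (x - 1) 0);
  lra.
Qed.

Lemma tent_outside (x : R) : x <= 0 \/ 1 <= x -> tent x = 0.
Proof.
rewrite /tent => -[] ?; case: (leP x 0); case: (leP (x - 2^-1) 0);
  case: (leP (x - 1) 0); lra.
Qed.

Lemma smooth_step_left (x : R) : x <= 0 -> smooth_step x = 0.
Proof.
move=> x0; rewrite /smooth_step /pos_sq !max_r//; lra.
Qed.

Lemma smooth_step_right (x : R) : 1 <= x -> smooth_step x = 1.
Proof.
move=> x1; rewrite /smooth_step /pos_sq !max_l//; lra.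
Qed.

Lemma smooth_step_itv (x : R) : 0 <= smooth_step x <= 1.
Proof.
rewrite /smooth_step /pos_sq.
case: (leP x 0); case: (leP (x - 2^-1) 0); case: (leP (x - 1) 0); nra.
Qed.

(** An approximate Dirac mass at [a], supported in [[a, a + e]]. *)
Definition bump (e a x : R) : R := tent ((x - a) / e) / e.

Lemma is_derive_step_shift (e a x : R) :
  is_derive x 1 (fun y => smooth_step ((y - a) / e)) (bump e a x).
Proof.
have dB : is_derive x 1 (fun y : R => (y - a) / e) e^-1.
  by apply: is_derive_eq; rewrite /GRing.scale/= subr0 mulr1 mulr0 add0r.
exact: (@is_derive1_comp _ smooth_step (fun y => (y - a) / e) x _ _
    (is_derive_smooth_step ((x - a) / e)) dB).
Qed.

Lemma continuous_bump (e a : R) : continuous (bump e a).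
Proof.
rewrite /bump => x; apply: cvgMl.
apply: (@continuous_comp R R R (fun y => (y - a) / e) tent);
  last exact: continuous_tent.
apply: cvgMl.
by apply: cvgB; [exact: cvg_id | exact: cvg_cst].
Qed.

Lemma bump_ge0 (e a x : R) : 0 < e -> 0 <= bump e a x.
Proof. by move=> e0; rewrite divr_ge0 ?tent_ge0// ltW. Qed.

Lemma bump_outside (e a x : R) : 0 < e -> x \notin `[a, a + e] -> bump e a x = 0.
Proof.
move=> e0; rewrite in_itv/= negb_and -!ltNge => /orP h.
rewrite /bump tent_outside ?mul0r// ler_pdivlMr// ler_pdivrMr//; lra.
Qed.

Lemma Rintegral_bump (e a : R) : 0 < e ->
  \int[mu]_(x in `[a, a + e]) bump e a x = 1.
Proof.
move=> e0; rewrite /Rintegral.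
have cS : continuous (fun y => smooth_step ((y - a) / e)).
  move=> x; apply/differentiable_continuous/derivable1_diffP.
  by have [] := is_derive_step_shift e a x.
rewrite (@continuous_FTC2 _ _ (fun y => smooth_step ((y - a) / e))).
- rewrite subrr mul0r [X in (X / e)]addrC addKr divff ?gt_eqF//.
  by rewrite (smooth_step_left (lexx 0)) (smooth_step_right (lexx 1))/= subr0.
- by rewrite ltrDl.
- exact/continuous_subspaceT/continuous_bump.
- split.
  + by move=> x _; have [] := is_derive_step_shift e a x.
  + exact/cvg_at_right_filter/cS.
  + exact/cvg_at_left_filter/cS.
- by move=> x _; rewrite derive1E; have [_ ->] := is_derive_step_shift e a x.
Qed.

Lemma Rintegral_support (D : set R) (f : R -> R) : measurable D ->
  (forall x, ~ D x -> f x = 0) ->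
  \int[mu]_x f x = \int[mu]_(x in D) f x.
Proof.
move=> mD f0; rewrite [RHS]Rintegral_mkcond; congr (Rintegral _ _ _).
apply/funext => x; rewrite patchE; case: ifPn => // /negP xD.
by apply: f0 => Dx; apply: xD; rewrite inE.
Qed.

Lemma integrable_support (D : set R) (f : R -> R) : measurable D ->
  (forall x, ~ D x -> f x = 0) ->
  mu.-integrable D (EFin \o f) -> mu.-integrable setT (EFin \o f).
Proof.
move=> mD f0 fD; have := (@integrable_mkcond _ _ R mu D (EFin \o f) mD).1 fD.
congr (_.-integrable _ _).
apply/funext => x; rewrite patchE; case: ifPn => //= /negP xD.
by rewrite f0// => Dx; apply: xD; rewrite inE.
Qed.

Lemma integrable_bump (f : R -> R) (e a : R) : 0 < e -> continuous f ->
  mu.-integrable `[a, a + e] (EFin \o (fun x => f x * bump e a x)).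
Proof.
move=> e0 cf; apply: continuous_compact_integrable; first exact: segment_compact.
apply/continuous_subspaceT => x; apply: cvgM; first exact: cf.
exact: continuous_bump.
Qed.

Lemma bump_outside_mul (f : R -> R) (e a x : R) : 0 < e ->
  ~ [set` `[a, a + e]] x -> f x * bump e a x = 0.
Proof. by move=> e0 /negP h; rewrite bump_outside// mulr0. Qed.

(** An average of [f] against a density carried by [[a, a + e]] is as close to
[f a] as [f] is on that interval. *)
Lemma Rintegral_bump_approx (f : R -> R) (e a d : R) : 0 < e -> continuous f ->
  (forall x, x \in `[a, a + e] -> `|f x - f a| <= d) ->
  `|\int[mu]_x (f x * bump e a x) - f a| <= d.
Proof.
move=> e0 cf fd.
rewrite (@Rintegral_support [set` `[a, a + e]])//; last first.
  by move=> x; exact: bump_outside_mul.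
have intc (c : R) : mu.-integrable `[a, a + e] (EFin \o (fun x => c * bump e a x)).
  by apply: (@integrable_bump (cst c)) => //; exact: cst_continuous.
have int1 : mu.-integrable `[a, a + e] (EFin \o bump e a).
  by have := intc 1; congr (_.-integrable _ _); apply/funext => x /=; rewrite mul1r.
have intE (c : R) : \int[mu]_(x in `[a, a + e]) (c * bump e a x) = c.
  by rewrite RintegralZl// Rintegral_bump// mulr1.
rewrite ler_distl; apply/andP; split.
  rewrite -[leLHS]intE; apply: le_Rintegral => //; first exact: integrable_bump.
  move=> x xD; rewrite ler_wpM2r ?bump_ge0//.
  by have := fd x xD; rewrite ler_distl => /andP[].
rewrite -[leRHS]intE; apply: le_Rintegral => //; first exact: integrable_bump.
move=> x xD; rewrite ler_wpM2r ?bump_ge0//.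
by have := fd x xD; rewrite ler_distl => /andP[].
Qed.

(** A test function that approximates the indicator of [[a, b]]; its derivative
approximates the difference of the Dirac masses at [a] and [b]. *)
Lemma C1c_plateau (e a b : R) : 0 < e ->
  let psi := fun x => smooth_step ((x - a) / e) - smooth_step ((x - b) / e) in
  C1c psi /\ derive1 psi = (fun x => bump e a x - bump e b x).
Proof.
move=> e0 psi.
have dpsi (x : R) : is_derive x 1 psi (bump e a x - bump e b x).
  by apply: is_deriveB; exact: is_derive_step_shift.
have psiE : derive1 psi = (fun x => bump e a x - bump e b x).
  by apply/funext => x; rewrite derive1E; have [_ ->] := dpsi x.
split=> //; split.
- by move=> x; have [] := dpsi x.
- by rewrite psiE => x; apply: cvgB; exact: continuous_bump.
- exists (`|a| + `|b| + e) => x; rewrite /psi.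
  have := ler_norm a; have := ler_norm b.
  have := ler_norm (- a); have := ler_norm (- b); rewrite !normrN => ? ? ? ?.
  case: (leP 0 x) => x0;
    [rewrite [`|x|]ger0_norm// | rewrite [`|x|]ltr0_norm//] => h.
    by rewrite !smooth_step_right ?subrr// ler_pdivlMr//; lra.
  by rewrite !smooth_step_left ?subrr// ler_pdivrMr//; lra.
Qed.

End SmoothStep.

(** Against a plateau over [[a, b]] with flanks of width [e], the left-hand side
of the weak formulation tends to [phi a - phi b] as [e] tends to [0], by
continuity of [phi], while the right-hand side is at most the essential bound of
[dphi] times the length [b + e - a] of the support. *)
Lemma weak_derivative_lipschitz (R : realType) (phi dphi : R -> R) :
  continuous phi -> weak_derivative phi dphi -> Loo dphi ->
  forall a b, `|phi b - phi a| <= norm_oo dphi * `|b - a|.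
Proof.
move=> cphi [_ _ wd] dphi_oo.
set M := norm_oo dphi; have M0 : 0 <= M := norm_oo_ge0 dphi.
suff H a b : a < b -> `|phi b - phi a| <= M * (b - a).
  move=> a b; case: (ltgtP a b) => [ab|ba|->].
  - by rewrite [`|b - a|]gtr0_norm ?subr_gt0// H.
  - by rewrite distrC [`|b - a|]ltr0_norm ?subr_lt0// opprB H.
  - by rewrite !subrr !normr0 mulr0.
move=> ab; apply/ler_addgt0Pr => d d0.
(* [d] pays for the oscillation of [phi] at [a] and at [b], and for the
   contribution [M * e] of the right flank. *)
pose d' := d / (M + 2).
have d'0 : 0 < d' by rewrite divr_gt0//; lra.
have osc (c : R) : exists2 e, 0 < e &
    forall x, `|x - c| <= e -> `|phi x - phi c| <= d'.
  have /cvgrPdist_le/(_ _ d'0) := cphi c.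
  move=> /nbhs_normP[e /= e0 he]; exists (e / 2); first by rewrite divr_gt0.
  move=> x xc; rewrite distrC; apply: he => /=; rewrite distrC.
  by apply: le_lt_trans xc _; rewrite ltr_pdivrMr// ltr_pMr// ltr1n.
have [ea ea0 ha] := osc a; have [eb eb0 hb] := osc b.
pose e := Num.min d' (Num.min ea eb).
have e0 : 0 < e by rewrite !lt_min d'0 ea0 eb0.
have eE : [/\ e <= d', e <= ea & e <= eb] by rewrite /e !ge_min !lexx !orbT.
have [ed eea eeb] := eE.
have near_c (c : R) x : x \in `[c, c + e] -> `|x - c| <= e.
  by rewrite in_itv/= => /andP[h1 h2]; rewrite ger0_norm; lra.
have [psiC dpsi] := C1c_plateau a b e0.
set psi := (fun x => _) in psiC dpsi.
have := wd _ psiC; rewrite dpsi.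
have -> : (fun x => phi x * (bump e a x - bump e b x)) =
          (fun x => phi x * bump e a x - phi x * bump e b x).
  by apply/funext => x; rewrite mulrBr.
have intb c : (@lebesgue_measure R).-integrable setT
    (EFin \o (fun x => phi x * bump e c x)).
  apply: (@integrable_support _ [set` `[c, c + e]]) => //.
    by move=> x; exact: bump_outside_mul.
  exact: integrable_bump.
rewrite RintegralB// => wdE.
have apa := @Rintegral_bump_approx _ phi e a d' e0 cphi
  (fun x xI => ha x (le_trans (near_c a x xI) eea)).
have apb := @Rintegral_bump_approx _ phi e b d' e0 cphi
  (fun x xI => hb x (le_trans (near_c b x xI) eeb)).
have psi_out x : ~ [set` `[a, b + e]] x -> dphi x * psi x = 0.
  move=> /negP; rewrite in_itv/= negb_and -!ltNge => /orP h.
  rewrite /psi; case: h => h.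
    by rewrite !smooth_step_left ?subrr ?mulr0// ler_pdivrMr//; lra.
  by rewrite !smooth_step_right ?subrr ?mulr0// ler_pdivlMr//; lra.
have [] := @Rintegral_ae_bounded R (fun x => dphi x * psi x) a (b + e) M.
- lra.
- exact: M0.
- apply: measurable_funM; first exact: measurable_funTS (Loo_measurable dphi_oo).
  apply: measurable_funTS; apply: continuous_measurable_fun => x.
  apply/differentiable_continuous/derivable1_diffP.
  by have [+ _ _] := psiC; exact.
- have := ae_le_norm_oo dphi_oo.
  apply: (@filterS _ _ (ae_filter_ringOfSetsType (@lebesgue_measure R))) => x hx _.
  rewrite normrM -[leRHS]mulr1 ler_pM//.
  have /andP[? ?] := smooth_step_itv ((x - a) / e).
  have /andP[? ?] := smooth_step_itv ((x - b) / e).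
  by rewrite ler_norml /psi; lra.
move=> _; rewrite -(@Rintegral_support _ _ (fun x => dphi x * psi x))// => hM.
have dE : d = 2 * d' + M * d' by rewrite /d'; field; lra.
have Me : M * (b + e - a) <= M * (b - a) + M * d'.
  by rewrite -mulrDr ler_wpM2l//; lra.
move: apa apb hM wdE; rewrite ![`|_| <= _]ler_norml.
move=> /andP[? ?] /andP[? ?] /andP[? ?] ?.
apply/andP; split; lra.
Qed.

(** * The initial spacing *)

Section InitialDatum.
Context {R : realType} (rho : R -> R).
Local Notation mu := (@lebesgue_measure R).

(** Every point off the support has a neighbourhood where [rho] vanishes almost
everywhere, and this neighbourhood can be taken with rational end points: the
exceptional set is a countable union of null sets. *)
Lemma ae_eq0_off_ess_support :
  {ae mu, forall y, ~ ess_support rho y -> rho y = 0}.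
Proof.
pose null (k : nat) (y : R) := exists p q : rat,
  [/\ @unpickle (rat * rat)%type k = Some (p, q),
      {ae mu, forall z, ratr p < z < ratr q -> rho z = 0},
      ratr p < y < ratr q & rho y <> 0].
have Nnull k : mu.-negligible (null k).
  case E : (@unpickle (rat * rat)%type k) => [[p q]|]; last first.
    apply: negligibleS (negligible_set0 mu) => y [p [q []]].
    by rewrite E.
  have [h|h] := pselect {ae mu, forall z, ratr p < z < ratr q -> rho z = 0};
    last first.
    apply: negligibleS (negligible_set0 mu) => y [p' [q' []]].
    by rewrite E => -[<- <-] /h.
  apply: negligibleS h => y [p' [q' []]].
  by rewrite E => -[<- <-] _ yI y0 /(_ yI).
apply: negligibleS (negligible_bigcup Nnull) => y /=.
move=> /not_implyP[yE y0]; move: yE; rewrite /ess_support/=.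
move=> /existsNP[U /not_implyP[yU /contrapT aeU]].
have [e /= e0 ye] := (nbhs_ballP _ _).1 yU.
have [p] := @rat_in_itvoo R (y - e) y ltac:(lra).
rewrite in_itv/= => /andP[p1 p2].
have [q] := @rat_in_itvoo R y (y + e) ltac:(lra).
rewrite in_itv/= => /andP[q1 q2].
exists (pickle (p, q)) => //; exists p, q; split=> //.
- by rewrite pickleK.
- apply: (@filterS _ _ (ae_filter_ringOfSetsType mu)) aeU => z hz /andP[z1 z2].
  apply/hz/ye; rewrite /ball/= ltr_distl; apply/andP; split; lra.
- by rewrite p2.
Qed.

Context (rhoI : assumption_I rho).
Local Notation Rbar := (norm_oo rho).
Local Notation mass a b := (\int[mu]_(y in `[a, b]%classic) rho y).

Lemma mass_le (a b : R) : a <= b ->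
  mu.-integrable `[a, b] (EFin \o rho) /\ mass a b <= Rbar * (b - a).
Proof.
case: rhoI => rhooo _ _ _ _ ab.
have [] := @Rintegral_ae_bounded R rho a b Rbar ab (norm_oo_ge0 _).
- exact: measurable_funTS (Loo_measurable rhooo).
- have := ae_le_norm_oo rhooo.
  by apply: (@filterS _ _ (ae_filter_ringOfSetsType mu)) => x hx _.
- by move=> int h; split=> //; apply: le_trans h; exact: ler_norm.
Qed.

Lemma mass_ge0 (a b : R) : 0 <= mass a b.
Proof.
case: rhoI => rhooo _ rho0 _ _; have mrho := Loo_measurable rhooo.
have -> : mass a b = \int[mu]_(y in `[a, b]%classic) `|rho y|.
  congr fine; apply: ae_eq_integral => //.
  - by apply/measurable_EFinP; exact: measurable_funTS mrho.
  - apply/measurable_EFinP; apply: measurable_funTS.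
    exact: measurableT_comp mrho.
  - apply: (@filterS _ _ (ae_filter_ringOfSetsType mu)) rho0 => x x0 _ /=.
    by rewrite ger0_norm.
by apply: Rintegral_ge0 => x _.
Qed.

Lemma mass_cat (a b c : R) : a <= b -> b <= c ->
  mass a c = mass a b + mass b c.
Proof.
move=> ab bc; have [int _] := mass_le (le_trans ab bc).
have := @Rintegral_itvB _ rho (BLeft a) (BRight c) b int.
rewrite !bnd_simp Rintegral_itv_obnd_cbnd; last first.
  by apply: integrableS int => //; apply: subset_itv; rewrite bnd_simp.
by move=> /(_ ab bc) <-; rewrite addrC subrK.
Qed.

Lemma mass_empty (a b : R) : b < a -> mass a b = 0.
Proof. by move=> ba; rewrite set_itv_ge ?Rintegral_set0// bnd_simp -ltNge. Qed.

Lemma mass_hull : mass (xmin rho) (xmax rho) = 1.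
Proof.
case: rhoI => rhooo _ rho0 cE rho1; have mrho := Loo_measurable rhooo.
have [M [_ HM]] := compact_bounded cE.
have HM' x : ess_support rho x -> `|x| <= `|M| + 1.
  move=> Ex; apply: (HM (`|M| + 1)) => //.
  by rewrite (le_lt_trans (ler_norm M))// ltrDl.
have Eub : has_ubound (ess_support rho).
  by exists (`|M| + 1) => x /HM'; apply: le_trans; exact: ler_norm.
have Elb : has_lbound (ess_support rho).
  by exists (- (`|M| + 1)) => x /HM'; rewrite ler_norml => /andP[].
set D := `[xmin rho, xmax rho]%classic.
have mD : measurable D by exact: measurable_itv.
rewrite Rintegral_mkcond /Rintegral; apply: EFin_inj.
have -> : (\int[mu]_x ((rho \_ D) x)%:E = 1)%E.
  rewrite -rho1 Lnorm1; apply/esym; apply: ae_eq_integral => //.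
  - by do 2 apply: measurableT_comp => //.
  - apply/measurable_EFinP/(measurable_restrictT _ _).1 => //.
    exact: measurable_funTS mrho.
  - have := ae_eq0_off_ess_support; move: rho0.
    apply: (@filterS2 _ _ (ae_filter_ringOfSetsType mu)) => x x0 xE _ /=.
    rewrite ger0_norm// patchE; case: ifPn => // /negP xD.
    rewrite xE// => Ex; apply: xD; rewrite inE /D/= in_itv/=.
    by rewrite (ge_inf Elb)// (ub_le_sup Eub).
by [].
Qed.

Lemma xmin_le_xmax : xmin rho <= xmax rho.
Proof.
rewrite leNgt; apply/negP => /mass_empty; rewrite mass_hull => /eqP.
by rewrite oner_eq0.
Qed.

Lemma norm_oo_gt0 : 0 < Rbar.
Proof.
rewrite lt_neqAle norm_oo_ge0 andbT; apply/negP => /eqP R0.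
have [_] := mass_le xmin_le_xmax.
by rewrite mass_hull -R0 mul0r ler10.
Qed.

Lemma mass_le_mono (a b c : R) : b <= c -> mass a b <= mass a c.
Proof.
move=> bc; case: (leP a b) => ab; first by rewrite (mass_cat ab bc) lerDl mass_ge0.
by rewrite mass_empty// mass_ge0.
Qed.

(** The mass of [[a, x]] is monotone and Lipschitz with constant [Rbar] in [x]:
it needs a length [l / Rbar] to reach [l], and does not jump over [l]. *)
Lemma quantile_step (a b l : R) : a <= b -> 0 < l -> l <= mass a b ->
  let s := sup [set x : R | mass a x < l] in
  [/\ a + l / Rbar <= s, s <= b & mass a s <= l].
Proof.
move=> ab l0 lab; set S := [set x | _].
have Rb0 := norm_oo_gt0.
have aS : S a.
  have [_] := mass_le (lexx a); rewrite subrr mulr0 /S /= => h.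
  exact: le_lt_trans h l0.
have bS : ubound S b.
  move=> x xS; rewrite leNgt; apply/negP => bx.
  have := le_trans lab (mass_le_mono a (ltW bx)); rewrite leNgt => /negP; apply.
  exact: xS.
have hS : has_sup S by split; [exists a | exists b].
have as_ : a <= sup S by exact: sup_upper_bound.
split; last 2 first.
- by apply: ge_sup => //; exists a.
- apply/ler_addgt0Pr => d d0.
  have [x xS hx] := sup_adherent (divr_gt0 d0 Rb0) hS.
  have xs : x <= sup S by exact: sup_upper_bound.
  have [ax|xa] := leP a x.
    have [_ h] := mass_le xs; rewrite (mass_cat ax xs) lerD//; first exact: ltW.
    apply: le_trans h _; rewrite -ler_pdivlMl// mulrC; lra.
  have [_ h] := mass_le as_; apply: le_trans h _; rewrite -ler_pdivlMl//.
  have : 0 <= Rbar^-1 * l by rewrite mulr_ge0 ?invr_ge0// ltW.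
  rewrite mulrDr [Rbar^-1 * d]mulrC; lra.
- rewrite leNgt; apply/negP => sl.
  pose x := (sup S + (a + l / Rbar)) / 2.
  have ax : a <= x by rewrite /x; lra.
  have : S x.
    have [_ h] := mass_le ax; apply: le_lt_trans h _.
    by rewrite -ltr_pdivlMl// mulrC /x; lra.
  move=> /(sup_upper_bound hS); rewrite /x; lra.
Qed.

Lemma ell_le (n j : nat) : (j < n)%N -> ell n <= 1 - j%:R * ell n :> R.
Proof.
move=> jn; have n0 : (0 < n)%N by exact: leq_ltn_trans jn.
have nE : n%:R * ell n = 1 :> R by rewrite divff// pnatr_eq0 -lt0n.
have l0 : 0 <= ell n :> R by rewrite invr_ge0.
have : j.+1%:R * ell n <= n%:R * ell n :> R by rewrite ler_wpM2r// ler_nat.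
by rewrite nE -natr1; lra.
Qed.

(** The mass still available to the right of the particle [j]: it is at least
[ell n] by [ell_le], and this is what bounds the set whose supremum is the next
particle. *)
Lemma xbar_rec_mass (n j : nat) : (j < n)%N ->
  xbar_rec rho n j <= xmax rho /\
  1 - j%:R * ell n <= mass (xbar_rec rho n j) (xmax rho).
Proof.
elim: j => [|j IH] jn.
  split; first exact: xmin_le_xmax.
  by rewrite /= mass_hull mul0r subr0.
have jn' : (j < n)%N by exact: ltnW.
have [aM am] := IH jn'.
have l0 : 0 < ell n :> R by rewrite invr_gt0 ltr0n (leq_ltn_trans _ jn).
have [h1 h2 h3] := quantile_step aM l0 (le_trans (ell_le jn') am).
split; first exact: h2.
have Rb0 := norm_oo_gt0.
have as_ : xbar_rec rho n j <= xbar_rec rho n j.+1.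
  by apply: le_trans h1; rewrite lerDl divr_ge0// ltW.
move: am; rewrite (mass_cat as_ h2) -natr1; lra.
Qed.

(** The last gap ends at [xmax] by decree, not by a supremum, but its mass is
what the first [n - 1] cells leave, at least [ell n]. *)
Lemma initial_gap (n i : nat) : (i < n)%N ->
  ell n / Rbar <= xbar rho n i.+1 - xbar rho n i.
Proof.
move=> ltin; have [aM am] := xbar_rec_mass ltin.
have lm := le_trans (ell_le ltin) am.
have Rb0 := norm_oo_gt0.
have l0 : 0 < ell n :> R by rewrite invr_gt0 ltr0n (leq_ltn_trans _ ltin).
rewrite /xbar (ltn_eqF ltin); case: eqP => _.
  rewrite ler_pdivrMr// mulrC; apply: le_trans lm _.
  by have [] := mass_le aM.
by have [h _ _] := quantile_step aM l0 lm; rewrite lerBrDl.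
Qed.

End InitialDatum.

(** * Signs of the particles, and the four systems *)

(** The initial positions increase with the index, so the nonpositive ones form
an initial segment, and [k_index] is its last index. *)
Lemma k_indexP (R : realType) (rho : R -> R) (n i : nat) :
  assumption_I rho -> (i <= n)%N ->
  if i%:Z <= k_index rho n then xbar rho n i <= 0 else 0 < xbar rho n i.
Proof.
move=> rhoI lein.
have gap0 : 0 <= ell n / norm_oo rho.
  by rewrite divr_ge0 ?norm_oo_ge0// invr_ge0.
have mono (a d : nat) : (a + d <= n)%N -> xbar rho n a <= xbar rho n (a + d).
  elim: d => [|d IH] h; first by rewrite addn0.
  rewrite addnS in h *; apply: le_trans (IH (ltnW h)) _.
  by rewrite -subr_ge0; apply: le_trans gap0 _; exact: initial_gap.
case: ifPn => [|ki].
  apply: contraTT; rewrite -!ltNge /k_index => xi.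
  apply/bigmax_ltP; split=> // j xj.
  rewrite ltz_nat ltnNge; apply/negP => ij.
  have := mono i (j - i)%N; rewrite subnKC// => /(_ (ltn_ord j)).
  by move=> /(lt_le_trans xi); rewrite ltNge xj.
rewrite ltNge; apply/negP => xi; move/negP: ki; apply.
exact: (@le_bigmax_cond _ _ _ _ (@Ordinal n.+1 i lein) _ (fun i : 'I_n.+1 => i%:Z)).
Qed.

(** If [phi 0] were nonzero, [phi] would keep its sign near [0], on both sides;
the Lipschitz bound makes the radius [|phi 0| / (L + 1)] explicit. *)
Lemma sign_change_root (R : realType) (phi : R -> R) (L : R) :
  (forall a b, `|phi b - phi a| <= L * `|b - a|) ->
  (forall x, 0 <= x * phi x) -> phi 0 = 0.
Proof.
move=> lip xphi; apply/eqP/negPn/negP => p0.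
have L0 : 0 <= L.
  by have := lip 0 1; rewrite subr0 normr1 mulr1; apply: le_trans.
(* A point on the side of [0] where the sign of [phi 0] is the wrong one. *)
pose x := - phi 0 / (L + 1).
have xE : phi 0 = - x * (L + 1) by rewrite /x; field; lra.
have x0 : x != 0 by apply: contra p0 => /eqP x0; rewrite xE x0 oppr0 mul0r.
have h : `|phi x - phi 0| <= L * `|x| by have := lip 0 x; rewrite subr0.
have : `|x| * `|phi x - phi 0| <= `|x| * (L * `|x|) by rewrite ler_wpM2l.
rewrite -normrM mulrCA -normrM -expr2 (ger0_norm (sqr_ge0 _)) ler_norml.
move=> /andP[_]; rewrite mulrBr xE.
have : 0 < x ^+ 2 by rewrite exprn_even_gt0.
have := xphi x; lra.
Qed.

Theorem proposition2p2 (R : realType) (v rho phi dphi : R -> R) (n : nat)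
    (hV : assumption_V v) (hI : assumption_I rho)
    (hP : assumption_P phi dphi) (hn : (0 < n)%N) :
  let Rbar := norm_oo rho in
  let L' := v 0 * norm_oo dphi in
  let k := k_index rho n in
  [/\ (forall x : R, 0 <= phi x) ->
      forall (tau : \bar R) (x : nat -> R -> R),
        ftl_solution n (speed1 v n) phi (xbar rho n) tau x ->
        forall (t : R) (i : nat), 0 <= t -> (t%:E < tau)%E -> (i < n)%N ->
          ell n / Rbar * expR (- (L' * t)) <= x i.+1 t - x i t,
      (forall x : R, phi x <= 0) ->
      forall (tau : \bar R) (x : nat -> R -> R),
        ftl_solution n (speed2 v n) phi (xbar rho n) tau x ->
        forall (t : R) (i : nat), 0 <= t -> (t%:E < tau)%E -> (i < n)%N ->
          ell n / Rbar * expR (- (L' * t)) <= x i.+1 t - x i t,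
      (forall x : R, 0 <= x * phi x) ->
      forall (tau : \bar R) (x : nat -> R -> R),
        ftl_solution n (speed3 v n k) phi (xbar rho n) tau x ->
        forall (t : R) (i : nat), 0 <= t -> (t%:E < tau)%E -> (i < n)%N ->
          ell n / Rbar * expR (- (L' * t)) <= x i.+1 t - x i t &
      forall Rmax : R, assumption_Vstar v Rbar Rmax ->
      (forall x : R, x * phi x <= 0) ->
      forall (tau : \bar R) (x : nat -> R -> R),
        ftl_solution n (speed4 v n k) phi (xbar rho n) tau x ->
        forall (t : R) (i : nat), 0 <= t -> (t%:E < tau)%E -> (i < n)%N ->
          ell n / Rmax <= x i.+1 t - x i t].
Proof.
move=> Rbar L' k.
have [_ v_ge0 v_ninc] := hV.
have [cphi _ wphi [dphi_oo _]] := hP.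
have lip := weak_derivative_lipschitz cphi wphi dphi_oo.
have gap0 i : (i < n)%N -> ell n / Rbar <= xbar rho n i.+1 - xbar rho n i.
  exact: initial_gap.
have weight (t c g : R) : c <= expR (L' * t) * g -> c * expR (- (L' * t)) <= g.
  by rewrite expRN ler_pdivrMr ?expR_gt0// mulrC.
split.
- move=> phi_ge0 tau x sol t i t0 tt ltin; apply: weight.
  by apply: (diverging_gap v_ge0 v_ninc lip sol (k := -1)).
- move=> phi_le0 tau x sol t i t0 tt ltin; apply: weight.
  apply: (diverging_gap v_ge0 v_ninc lip sol (k := n%:Z)) => //.
  + by move=> y j jn; rewrite speed3_left.
  + by move=> j s jn; rewrite ltz_nat ltnNge jn.
- move=> xphi tau x sol t i t0 tt ltin; apply: weight.
  have phi0 := sign_change_root lip xphi.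
  have [_ xi xc _ xd] := sol.
  have V0 j (jn : (j <= n)%N) s : 0 < s -> (s%:E < tau)%E ->
      0 <= speed3 v n k (x^~ s) j <= v 0.
    move=> s0 stau; rewrite /speed3; case: ifP => _.
      exact: (speed_left_bounds v_ge0 v_ninc sol jn (ltW s0)).
    exact: (speed_right_bounds v_ge0 v_ninc sol jn (ltW s0)).
  apply: (diverging_gap v_ge0 v_ninc lip sol (k := k)) => //.
  + move=> j s jn jk s0 stau.
    have xj : x j s <= 0.
      apply: (equilibrium_barrierN phi0 lip (V0 j jn) (xc j jn)
        (fun s => xd j s jn)) => //.
      by rewrite xi//; have := k_indexP hI jn; rewrite jk.
    have := xphi (x j s); case: (ltgtP (x j s) 0) xj => // [xj _|-> _ _].
      by rewrite nmulr_rge0.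
    by rewrite phi0.
  + move=> j s jn jk s0 stau.
    have xj : 0 <= x j s.
      apply: (equilibrium_barrier phi0 lip (V0 j jn) (xc j jn)
        (fun s => xd j s jn)) => //.
      by rewrite xi// ltW//; have := k_indexP hI jn; rewrite leNgt jk.
    have := xphi (x j s); case: (ltgtP (x j s) 0) xj => // [xj _|-> _ _].
      by rewrite pmulr_rge0.
    by rewrite phi0.
- move=> Rmax [Rmax0 RR _ vR] xphi tau x sol t i t0 tt ltin.
  have phi0 : phi 0 = 0.
    have lipN a b : `|- phi b - - phi a| <= norm_oo dphi * `|b - a|.
      by rewrite -opprD normrN lip.
    apply: oppr_inj; rewrite oppr0.
    apply: (sign_change_root (phi := fun y => - phi y) lipN).
    by move=> y; rewrite mulrN oppr_ge0.
  have [_ xi xc _ xd] := sol.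
  have V0 j (jn : (j <= n)%N) s : 0 < s -> (s%:E < tau)%E ->
      0 <= speed4 v n k (x^~ s) j <= v 0.
    move=> s0 stau; rewrite /speed4; case: ifP => _.
      exact: (speed_right_bounds v_ge0 v_ninc sol jn (ltW s0)).
    exact: (speed_left_bounds v_ge0 v_ninc sol jn (ltW s0)).
  apply: (converging_gap v_ge0 v_ninc sol Rmax0 vR (k := k)) => //.
  + move=> j s jn jk s0 stau.
    have xj : x j s <= 0.
      apply: (equilibrium_barrierN phi0 lip (V0 j jn) (xc j jn)
        (fun s => xd j s jn)) => //.
      by rewrite xi//; have := k_indexP hI jn; rewrite jk.
    have := xphi (x j s); case: (ltgtP (x j s) 0) xj => // [xj _|-> _ _].
      by rewrite nmulr_rle0.
    by rewrite phi0.
  + move=> j s jn jk s0 stau.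
    have xj : 0 <= x j s.
      apply: (equilibrium_barrier phi0 lip (V0 j jn) (xc j jn)
        (fun s => xd j s jn)) => //.
      by rewrite xi// ltW//; have := k_indexP hI jn; rewrite leNgt jk.
    have := xphi (x j s); case: (ltgtP (x j s) 0) xj => // [xj _|-> _ _].
      by rewrite pmulr_rle0.
    by rewrite phi0.
  + move=> j jn; apply: le_trans (gap0 j jn).
    have Rb0 := norm_oo_gt0 hI.
    by rewrite ler_wpM2l ?invr_ge0// lef_pV2.
Qed.
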